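(* Let $f:\mathbb{R}^n\to\mathbb{R}$ be continuously differentiable with a minimizer $x_*$. Suppose that $\nabla f$ is Lipschitz continuous with constant $L>0$ and that $f$ is strongly convex with parameter $\mu>0$. Let $x_0\in\mathbb{R}^n$, let $(e_k)_{k\ge 0}$ be a sequence in $\mathbb{R}^n$, and define $x_{k+1}=x_k-\frac1L\big(\nabla f(x_k)+e_k\big)$ for $k\ge0$. Suppose that $\|e_k\|^2\le B_k$ for all $k\ge 0$, where $(B_k)_{k\ge0}$ is a sequence of positive real numbers for which the limit of $B_{k+1}/B_k$ exists and $$\lim_{k\to\infty} \frac{B_{k+1}}{B_k}\le 1 .$$ Then for every $\epsilon>0$, $$f(x_k)-f(x_* )\le (1-\mu/L)^k\,[f(x_0)-f(x_* )]+\mathcal{O}(C_k),\qquad C_k=\max\{B_k,\,(1-\mu/L+\epsilon)^k\},$$ that is, there is a constant $K\ge 0$, independent of $k$, such that $f(x_k)-f(x_* )\le (1-\mu/L)^k[f(x_0)-f(x_* )]+K C_k$ for all $k\ge 0$.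
   Context: $\|\cdot\|$ is the Euclidean norm on $\mathbb{R}^n$. Lipschitz continuity of the gradient with constant $L$ means $\|\nabla f(x)-\nabla f(y)\|\le L\|x-y\|$ for all $x,y\in\mathbb{R}^n$. Strong convexity with parameter $\mu$ means $f(y)\ge f(x)+(y-x)^T\nabla f(x)+\frac{\mu}{2}\|y-x\|^2$ for all $x,y\in\mathbb{R}^n$. The iteration is gradient descent with constant step size $1/L$, where the gradient is computed with residual $e_k$. *)

(* Defs.v *)
From HB Require Import structures.
From mathcomp Require Import all_boot all_order all_algebra.
From mathcomp Require Import all_classical all_reals all_analysis.

Set Implicit Arguments.
Unset Strict Implicit.
Unset Printing Implicit Defensive.

Import Order.TTheory GRing.Theory Num.Theory.
Import numFieldNormedType.Exports.

Local Open Scope ring_scope.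

Definition dotp (R : realType) (n : nat) (u v : 'rV[R]_n) : R :=
  \sum_(i < n) u 0 i * v 0 i.

(* The library's norm on matrices is the sup norm, so the Euclidean norm needs
   its own definition; both induce the same topology on R^n. *)
Definition enorm (R : realType) (n : nat) (u : 'rV[R]_n) : R :=
  Num.sqrt (dotp u u).

Definition gradient (R : realType) (n : nat) (f : 'rV[R]_n -> R)
    (x : 'rV[R]_n) : 'rV[R]_n :=
  \row_(i < n) 'D_(delta_mx 0 i) f x.

Definition continuously_differentiable (R : realType) (n : nat)
    (f : 'rV[R]_n -> R) : Prop :=
  (forall x, differentiable f x) /\ continuous (gradient f).

Definition is_minimizer (R : realType) (n : nat) (f : 'rV[R]_n -> R)
    (xs : 'rV[R]_n) : Prop :=
  forall y, f xs <= f y.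

Definition gradient_lipschitz (R : realType) (n : nat) (f : 'rV[R]_n -> R)
    (L : R) : Prop :=
  forall x y, enorm (gradient f x - gradient f y) <= L * enorm (x - y).

Definition strongly_convex (R : realType) (n : nat) (f : 'rV[R]_n -> R)
    (mu : R) : Prop :=
  forall x y,
    f x + dotp (y - x) (gradient f x) + mu / 2 * enorm (y - x) ^+ 2 <= f y.

(* Main.v *)
(** One step decreases [f] by at least [(|g|^2 - |e_k|^2) / (2 L)], by the
    quadratic upper bound on [f], while strong convexity gives
    [2 mu (f - min f) <= |g|^2].  Hence [a_k = f (x_k) - min f] satisfies
    [a_(k+1) <= rho a_k + B_k / (2 L)] with [rho = 1 - mu / L], and the excess
    [u_k = a_k - rho^k a_0] satisfies the same recursion.  A solution of
    [u_(k+1) <= rho u_k + D_k] is [O(D_k)] as soon as [D] eventually grows by a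
    factor [q > rho] at each step.  If [lim B_(k+1) / B_k > rho + eps / 2] this
    applies to [D = B]; otherwise [B_k = O((rho + eps)^k)] and it applies to a
    multiple of [(rho + eps)^k]. *)
Require Import Defs.
From HB Require Import structures.
From mathcomp Require Import all_boot all_order all_algebra.
From mathcomp Require Import all_classical all_reals all_analysis.
From mathcomp Require Import ring lra.

Set Implicit Arguments.
Unset Strict Implicit.
Unset Printing Implicit Defensive.

Import Order.TTheory GRing.Theory Num.Theory.
Import numFieldNormedType.Exports.

Local Open Scope classical_set_scope.
Local Open Scope ring_scope.

(** * Bilinearity and positivity of the Euclidean inner product *)

Section DotProduct.
Variables (R : realType) (n : nat).
Implicit Types (u v w : 'rV[R]_n) (a : R).

Lemma dotpC u v : dotp u v = dotp v u.
Proof. by apply: eq_bigr => i _; rewrite mulrC. Qed.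

Lemma dotpDl u v w : dotp (u + v) w = dotp u w + dotp v w.
Proof. by rewrite /dotp -big_split; apply: eq_bigr => i _; rewrite mxE mulrDl. Qed.

Lemma dotpZl a u v : dotp (a *: u) v = a * dotp u v.
Proof. by rewrite /dotp mulr_sumr; apply: eq_bigr => i _; rewrite mxE mulrA. Qed.

Lemma dotpDr u v w : dotp u (v + w) = dotp u v + dotp u w.
Proof. by rewrite dotpC dotpDl !(dotpC _ u). Qed.

Lemma dotpZr a u v : dotp u (a *: v) = a * dotp u v.
Proof. by rewrite dotpC dotpZl dotpC. Qed.

Lemma dotpNl u v : dotp (- u) v = - dotp u v.
Proof. by rewrite -scaleN1r dotpZl mulN1r. Qed.

Lemma dotpNr u v : dotp u (- v) = - dotp u v.
Proof. by rewrite dotpC dotpNl dotpC. Qed.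

Definition dotpE := (dotpDl, dotpDr, dotpNl, dotpNr, dotpZl, dotpZr).

Lemma dotp_ge0 u : 0 <= dotp u u.
Proof. by apply: sumr_ge0 => i _; rewrite -expr2 sqr_ge0. Qed.

Lemma dotp_gt0 u : u != 0 -> 0 < dotp u u.
Proof.
move=> u0; rewrite lt_def dotp_ge0 andbT; apply: contra u0.
rewrite psumr_eq0 => [|i _]; last by rewrite -expr2 sqr_ge0.
move=> /allP u0; apply/eqP/rowP => i; rewrite mxE.
by have := u0 i (mem_index_enum i); rewrite mulf_eq0 orbb => /eqP.
Qed.

Lemma sqr_enorm u : enorm u ^+ 2 = dotp u u.
Proof. by rewrite sqr_sqrtr ?dotp_ge0. Qed.

End DotProduct.

(** * Descent estimates for one inexact gradient step *)

Section SmoothStronglyConvex.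
Variables (R : realType) (n : nat) (f : 'rV[R]_n -> R) (L mu : R).
Hypotheses (L0 : 0 < L) (fL : gradient_lipschitz f L).
Hypotheses (mu0 : 0 < mu) (fmu : strongly_convex f mu).

Implicit Types x y d e : 'rV[R]_n.

Let g := gradient f.

(** Cauchy-Schwarz is bypassed: with [v = g y - g x] and [w = y - x], expand [|v - L w|^2 >= 0] and
    insert [|v|^2 <= L^2 |w|^2]. *)
Lemma dotp_gradientB_le x y :
  dotp (g y - g x) (y - x) <= L * dotp (y - x) (y - x).
Proof.
have h : dotp (g y - g x) (g y - g x) <= L ^+ 2 * dotp (y - x) (y - x).
  rewrite -!sqr_enorm -exprMn ler_sqr ?nnegrE ?sqrtr_ge0 ?fL //.
  by rewrite mulr_ge0 ?sqrtr_ge0 ?ltW.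
have := dotp_ge0 (g y - g x - L *: (y - x)).
move: (g y - g x) (y - x) h => u v h.
rewrite !dotpE (dotpC v u) => h2.
rewrite -(ler_pM2l L0); nra.
Qed.

(** Adding the strong convexity inequalities at [(x, y)] and [(y, x)] makes the gradient strongly
    monotone, which is compared with the previous upper bound. *)
Lemma strongly_convex_le_lipschitz x y : y != x -> mu <= L.
Proof.
rewrite -subr_eq0 => /dotp_gt0 d0; rewrite -(ler_pM2r d0).
have := fmu x y; have := fmu y x; have := dotp_gradientB_le x y.
rewrite !sqr_enorm -/g -(opprB y x); move: (y - x) => d.
rewrite !dotpE !(dotpC d); lra.
Qed.

(* Convexity bounds each increment along a segment cut into steps [h *: d] by
   the slope at the end point of the step. *)
Lemma quadratic_bound_steps x d (h : R) j : 0 < h ->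
  f (x + (j%:R * h) *: d) <= f x + j%:R * h * dotp (g x) d
    + L * dotp d d * h ^+ 2 * (j%:R * (j%:R + 1)) / 2.
Proof.
move=> h0; elim: j => [|j IH].
  by rewrite !mul0r scale0r addr0 mulr0 mul0r !addr0.
set z := x + (j%:R * h) *: d in IH.
set y := x + (j.+1%:R * h) *: d.
have s0 : 0 < j.+1%:R * h by rewrite mulr_gt0 ?ltr0n.
have yx : y - x = (j.+1%:R * h) *: d by rewrite /y addrC addKr.
have zy : z - y = - (h *: d).
  rewrite /z /y opprD addrACA subrr add0r -scalerBl -[RHS]scaleNr; congr (_ *: _).
  by rewrite -natr1; ring.
have slope : dotp (g y) d <= dotp (g x) d + L * (j.+1%:R * h) * dotp d d.
  rewrite -(ler_pM2l s0); have := dotp_gradientB_le x y.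
  rewrite yx !dotpE; nra.
have := fmu y z; rewrite sqr_enorm zy -/g !dotpE (dotpC d).
have d0 := mulr_ge0 (sqr_ge0 h) (dotp_ge0 d).
have := ler_wpM2l (ltW h0) slope.
have := mulr_ge0 (ltW mu0) d0.
rewrite -natr1; nra.
Qed.

(** Cutting the segment into [m + 1] equal steps gives the bound up to an error [c / (m + 1)], which
    is arbitrarily small. *)
Lemma quadratic_upper_bound x d :
  f (x + d) <= f x + dotp (g x) d + L / 2 * dotp d d.
Proof.
apply/ler_addgt0Pr => r r0; set c := L / 2 * dotp d d.
have c0 : 0 <= c by rewrite mulr_ge0 ?dotp_ge0 ?divr_ge0 ?ltW.
have [m cm] : exists m : nat, c < r * m.+1%:R.
  exists (Num.truncn (c / r)); rewrite mulrC -ltr_pdivrMr //.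
  exact: truncnS_gt.
have m0 : m.+1%:R != 0 :> R by rewrite pnatr_eq0.
have h0 : 0 < m.+1%:R^-1 :> R by rewrite invr_gt0 ltr0n.
have := quadratic_bound_steps x d m.+1 h0.
rewrite divff // scale1r mul1r => /le_trans; apply.
have -> : L * dotp d d * m.+1%:R^-1 ^+ 2 * (m.+1%:R * (m.+1%:R + 1)) / 2
    = c + c / m.+1%:R by rewrite /c; field.
by rewrite addrA lerD2l ler_pdivrMr ?ltr0n // ltW.
Qed.

(** The quadratic minorant of [f] at [x] is smallest at [d = - g x / mu]; expanding
    [|g x + mu d|^2 >= 0] expresses this. *)
Lemma gradient_dominance x y : 2 * mu * (f x - f y) <= dotp (g x) (g x).
Proof.
have := fmu x y; rewrite sqr_enorm -/g; move: (y - x) => d.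
have := dotp_ge0 (g x + mu *: d); rewrite !dotpE (dotpC d) => h1 h2.
have := ler_wpM2l (ltW mu0) h2; nra.
Qed.

Lemma inexact_gradient_step x e y :
  f (x - L^-1 *: (g x + e)) - f y
    <= (1 - mu / L) * (f x - f y) + (2 * L)^-1 * dotp e e.
Proof.
have := quadratic_upper_bound x (- (L^-1 *: (g x + e))).
rewrite !dotpE (dotpC e (g x)); set fx := f (x - _).
(* For step size [1 / L] the cross terms in [dotp (g x) e] cancel exactly. *)
rewrite [X in _ <= X](_ : _ =
  f x + (2 * L)^-1 * dotp e e - (2 * L)^-1 * dotp (g x) (g x)); last first.
  by field; rewrite gt_eqF.
have L2 : 0 <= (2 * L)^-1 by rewrite invr_ge0 mulr_ge0 ?ltW.
have := ler_wpM2l L2 (gradient_dominance x y).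
have -> : (2 * L)^-1 * (2 * mu * (f x - f y)) = mu / L * (f x - f y).
  by field; rewrite gt_eqF.
lra.
Qed.

End SmoothStronglyConvex.

(** * Scalar recursions with a perturbation *)

Section PerturbedGeometricDecay.
Variable R : realType.
Implicit Types (u D B : nat -> R) (rho q eps : R).

(** The finitely many indices below [N] are absorbed by enlarging the constant. *)
Lemma eventually_le_scale u D N K : (forall k, 0 < D k) ->
  (forall k, (N <= k)%N -> u k <= K * D k) ->
  exists2 M, 0 <= M & forall k, u k <= M * D k.
Proof.
move=> D0 uK.
have S0 j : 0 <= \sum_(i < j) `|u i / D i| by apply: sumr_ge0.
exists (`|K| + \sum_(i < N) `|u i / D i|); first by rewrite addr_ge0.
move=> k; have [/uK/le_trans|kN] := leqP N k.
  by apply; rewrite ler_pM2r // ler_wpDr // ler_norm.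
rewrite -ler_pdivrMr // (le_trans (ler_norm _)) // ler_wpDl //.
rewrite (bigD1 (Ordinal kN)) //= lerDl; exact: sumr_ge0.
Qed.

(** Induction from [N]: [K >= 1 / (q - rho)] gives [rho K + 1 <= K q], so [u k <= K D k] yields [u
    k.+1 <= (rho K + 1) D k <= K q D k <= K D k.+1]. *)
Lemma perturbed_decay_le u D rho q N : 0 <= rho -> rho < q ->
  (forall k, 0 < D k) ->
  (forall k, (N <= k)%N -> q * D k <= D k.+1) ->
  (forall k, u k.+1 <= rho * u k + D k) ->
  exists2 M, 0 <= M & forall k, u k <= M * D k.
Proof.
move=> rho0 rhoq D0 Dq uD; set K := `|u N / D N| + (q - rho)^-1.
have qr0 : 0 < q - rho by rewrite subr_gt0.
have K0 : 0 <= K by rewrite addr_ge0 // invr_ge0 ltW.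
have Kq : rho * K + 1 <= K * q.
  have : (q - rho) * (q - rho)^-1 <= (q - rho) * K.
    by rewrite ler_pM2l // lerDr.
  rewrite divff ?gt_eqF //; lra.
apply: (@eventually_le_scale u D N K) => // k /subnK <-.
elim: (k - N)%N => [|j IH].
  rewrite -ler_pdivrMr // add0n (le_trans (ler_norm _)) // lerDl.
  by rewrite invr_ge0 ltW.
rewrite addSn (le_trans (uD _)) //.
have := ler_wpM2l K0 (Dq _ (leq_addl j N)).
have := ler_wpM2l rho0 IH; have := ler_wpM2r (ltW (D0 (j + N)%N)) Kq.
lra.
Qed.

Lemma ratio_le_geometric B q N : 0 < q ->
  (forall k, (N <= k)%N -> B k.+1 <= q * B k) ->
  exists2 M, 0 <= M & forall k, B k <= M * q ^+ k.
Proof.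
move=> q0 Bq; have qk k : 0 < q ^+ k by rewrite exprn_gt0.
apply: (@eventually_le_scale B _ N (B N / q ^+ N)) => // k /subnK <-.
elim: (k - N)%N => [|j IH]; first by rewrite add0n divfK ?gt_eqF.
rewrite addSn (le_trans (Bq _ (leq_addl j N))) // exprS mulrCA.
by rewrite ler_pM2l.
Qed.

Lemma perturbed_decay_le_max u B rho eps : 0 <= rho -> 0 < eps ->
  (forall k, 0 < B k) -> cvgn (fun k => B k.+1 / B k) ->
  (forall k, u k.+1 <= rho * u k + B k) ->
  exists2 M, 0 <= M &
    forall k, u k <= M * Num.max (B k) ((rho + eps) ^+ k).
Proof.
move=> rho0 eps0 B0 /cvgrPdist_lt; set l := limn _ => /(_ (eps / 4)) Bl uB.
have /Bl [N _ {}Bl] : 0 < eps / 4 by rewrite divr_gt0.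
have lB k : (N <= k)%N ->
    (l - eps / 4) * B k <= B k.+1 /\ B k.+1 <= (l + eps / 4) * B k.
  move=> /Bl /=; rewrite ltr_distlC ltr_pdivlMr // ltr_pdivrMr // => /andP[].
  by split; apply: ltW.
have q0 : 0 < rho + eps by rewrite ltr_wpDl.
(* With tolerance [eps / 4], the ratios eventually stay above [l - eps / 4 > rho] in the first case
   and below [l + eps / 4 < rho + eps] in the second. *)
have [lr|lr] := ltP (rho + eps / 2) l.
- have [M M0 uM] : exists2 M, 0 <= M & forall k, u k <= M * B k.
    apply: (@perturbed_decay_le u B rho (l - eps / 4) N) => //; first lra.
    by move=> k /lB[].
  by exists M => // k; rewrite (le_trans (uM k)) // ler_wpM2l // le_max lexx.
- have [C C0 BC] : exists2 C, 0 <= C & forall k, B k <= C * (rho + eps) ^+ k.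
    apply: (@ratio_le_geometric B _ N) => // k /lB[_ /le_trans]; apply.
    rewrite ler_pM2r //; lra.
  (* [C] may be zero; [C + 1] keeps the comparison sequence positive. *)
  have [M M0 uM] : exists2 M, 0 <= M &
      forall k, u k <= M * ((C + 1) * (rho + eps) ^+ k).
    apply: (@perturbed_decay_le u _ rho (rho + eps) 0%N) => //; first lra.
    + by move=> k; rewrite mulr_gt0 ?exprn_gt0 // ltr_wpDl.
    + by move=> k _; rewrite exprS mulrCA.
    + move=> k; rewrite (le_trans (uB k)) // lerD2l (le_trans (BC k)) //.
      by rewrite ler_pM2r ?exprn_gt0 // lerDl.
  exists (M * (C + 1)); first by rewrite mulr_ge0 // addr_ge0.
  move=> k; rewrite (le_trans (uM k)) // mulrA ler_wpM2l //.
    by rewrite mulr_ge0 // addr_ge0.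
  by rewrite le_max lexx orbT.
Qed.

End PerturbedGeometricDecay.

Theorem theorem2p2 (R : realType) (n : nat) (f : 'rV[R]_n -> R)
    (xs : 'rV[R]_n) (L mu : R)
    (x e : nat -> 'rV[R]_n) (B : nat -> R) :
  continuously_differentiable f ->
  is_minimizer f xs ->
  0 < L -> gradient_lipschitz f L ->
  0 < mu -> strongly_convex f mu ->
  (forall k, x k.+1 = x k - L^-1 *: (gradient f (x k) + e k)) ->
  (forall k, 0 < B k) ->
  (forall k, enorm (e k) ^+ 2 <= B k) ->
  cvgn (fun k => B k.+1 / B k) ->
  limn (fun k => B k.+1 / B k) <= 1 ->
  forall eps : R, 0 < eps ->
  exists K : R, 0 <= K /\
    forall k, f (x k) - f xs <=
      (1 - mu / L) ^+ k * (f (x 0%N) - f xs)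
      + K * Num.max (B k) ((1 - mu / L + eps) ^+ k).

Proof.
move=> _ _ L0 fL mu0 fmu xS B0 eB Bcvg _ eps eps0.
(* Two distinct points are needed for [mu <= L], which can fail in dimension 0. If all iterates
   equal [xs], both gaps vanish. *)
have [[m xm]|xxs] := pselect (exists m, x m != xs); last first.
  exists 0; split=> // k; have xE j : x j = xs.
    by apply/eqP/negP => /negP xj; apply: xxs; exists j.
  by rewrite !xE subrr mulr0 mul0r addr0.
have muL := strongly_convex_le_lipschitz L0 fL fmu xm.
have rho0 : 0 <= 1 - mu / L by rewrite subr_ge0 ler_pdivrMr ?mul1r.
(* The factor [2 * L] turns the perturbation [B k / (2 L)] into [B k]; it is divided out in the
   final constant. *)
pose u k := 2 * L * (f (x k) - f xs - (1 - mu / L) ^+ k * (f (x 0%N) - f xs)).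
have L2 : 0 < 2 * L by rewrite mulr_gt0.
have uS k : u k.+1 <= (1 - mu / L) * u k + B k.
  have := inexact_gradient_step L0 fL mu0 fmu (x k) (e k) xs.
  rewrite -xS => /(ler_wpM2l (ltW L2)); rewrite [leRHS]mulrDr mulVKf ?gt_eqF //.
  rewrite /u exprS; have := eB k; rewrite sqr_enorm.
  nra.
have [M M0 uM] := perturbed_decay_le_max rho0 eps0 B0 Bcvg uS.
exists (M / (2 * L)); split=> [|k]; first by rewrite divr_ge0 // ltW.
by rewrite -lerBlDl mulrAC ler_pdivlMr // mulrC uM.
Qed.
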